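(* Let $\mathbf a_0<_T\mathbf a_1<_T\mathbf a_2<_T\cdots$ be a strictly increasing sequence of Turing degrees, let $A=\bigcup_{n<\omega}\downarrow\mathbf a_n$, and let $\mathbf b$ be a Turing degree such that $\mathbf a_n\leq_T\mathbf b$ for every $n$ and $\mathbf b\notin A$. Define $U_{A,\mathbf b}:\operatorname{Idl}(\mathcal D_T)\to\operatorname{Idl}(\mathcal D_T)$ by $$U_{A,\mathbf b}(I)=\begin{cases}\langle I\cup\{\mathbf b\}\rangle,&A\subseteq I,\\ I,&A\nsubseteq I,\end{cases}$$ where $\langle S\rangle$ denotes the Turing ideal generated by $S$. Then $U_{A,\mathbf b}$ is monotone and inflationary (that is, $I\subseteq U_{A,\mathbf b}(I)$ for all $I$), but it is not Scott-continuous.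
   Context: Let $\mathcal D_T$ be the poset of Turing degrees under Turing reducibility $\leq_T$, with join $\mathbf a\vee\mathbf b=\deg_T(A\oplus B)$. A Turing ideal is a nonempty subset $I\subseteq\mathcal D_T$ that is closed downward under $\leq_T$ and closed under $\vee$; $\operatorname{Idl}(\mathcal D_T)$ is the set of Turing ideals ordered by inclusion. It is a dcpo in which directed suprema are unions. For a degree $\mathbf a$, $\downarrow\mathbf a=\{\mathbf c:\mathbf c\leq_T\mathbf a\}$. The Turing ideal generated by a nonempty set $S$ of degrees is the smallest Turing ideal containing $S$. A self-map of $\operatorname{Idl}(\mathcal D_T)$ is Scott-continuous if it preserves suprema of directed families. *)

(* Defs.v *)
From HB Require Import structures.
From mathcomp Require Import all_boot all_order.
From mathcomp Require Import all_classical.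

Set Implicit Arguments.
Unset Strict Implicit.
Unset Printing Implicit Defensive.
Import Order.Theory.
Local Open Scope classical_set_scope.

(* A k-ary partial function on nat is represented by its graph. *)
Definition pfun (k : nat) := k.-tuple nat -> nat -> Prop.

Definition total_graph k (g : k.-tuple nat -> nat) : pfun k :=
  fun v y => y = g v.

Definition comp_graph k m (g : 'I_m -> pfun k) (h : pfun m) : pfun k :=
  fun v y => exists2 w : m.-tuple nat, forall i, g i v (tnth w i) & h w y.

(* F(0, v) = g(v) and F(n + 1, v) = h(n, F(n, v), v) *)
Fixpoint iter_graph k (g : pfun k) (h : pfun k.+2) (v : k.-tuple nat)
    (n y : nat) : Prop :=
  if n is n'.+1
  then exists2 z, iter_graph g h v n' z & h [tuple of n' :: z :: v] y
  else g v y.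

Definition primrec_graph k (g : pfun k) (h : pfun k.+2) : pfun k.+1 :=
  fun v y => iter_graph g h [tuple of behead v] (thead v) y.

(* v |-> the least n with h(n, v) = 0, all the earlier values h(m, v) being
   defined (and nonzero) *)
Definition mu_graph k (h : pfun k.+1) : pfun k :=
  fun v n => h [tuple of n :: v] 0 /\
    forall m, m < n -> exists z, h [tuple of m :: v] z.+1.

(* The partial functions that are recursive in the oracle f (Kleene). *)
Inductive partial_recursive_in (f : nat -> nat) :
    forall k, pfun k -> Prop :=
| Oracle : partial_recursive_in f
    (total_graph (fun v : 1.-tuple nat => f (thead v)))
| Zero k : partial_recursive_in f (total_graph (fun _ : k.-tuple nat => 0))
| Succ : partial_recursive_in f
    (total_graph (fun v : 1.-tuple nat => (thead v).+1))
| Proj k (i : 'I_k) : partial_recursive_in f (total_graph (fun v => tnth v i))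
| Comp k m (g : 'I_m -> pfun k) (h : pfun m) :
    (forall i, partial_recursive_in f (g i)) -> partial_recursive_in f h ->
    partial_recursive_in f (comp_graph g h)
| Primrec k (g : pfun k) (h : pfun k.+2) :
    partial_recursive_in f g -> partial_recursive_in f h ->
    partial_recursive_in f (primrec_graph g h)
| Mu k (h : pfun k.+1) :
    partial_recursive_in f h -> partial_recursive_in f (mu_graph h).

Definition char_fun (A : set nat) (n : nat) : nat := n \in A.

Definition turing_reducible (A B : set nat) : Prop :=
  partial_recursive_in (char_fun B)
    (total_graph (fun v : 1.-tuple nat => char_fun A (thead v))).

Definition turing_join (A B : set nat) : set nat :=
  [set n.*2 | n in A] `|` [set n.*2.+1 | n in B].

Lemma turing_reducible_refl A : turing_reducible A A.
Proof. exact: Oracle. Qed.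

Lemma turing_reducible_trans B A C :
  turing_reducible A B -> turing_reducible B C -> turing_reducible A C.
Proof.
rewrite /turing_reducible => AB BC; elim: AB => //; by constructor.
Qed.

Section TotalRecursive.
Variable f : nat -> nat.
Implicit Types k m : nat.

Let rec k (g : k.-tuple nat -> nat) := partial_recursive_in f (total_graph g).

Let rec_ext k (g g' : k.-tuple nat -> nat) : g =1 g' -> rec g -> rec g'.
Proof. by move=> /funext ->. Qed.

Let rec_comp k m (g : 'I_m -> k.-tuple nat -> nat) (h : m.-tuple nat -> nat) :
  (forall i, rec (g i)) -> rec h -> rec (fun v => h [tuple g i v | i < m]).
Proof.
move=> rg rh; rewrite /rec.
rewrite (_ : total_graph _ =
  comp_graph (fun i => total_graph (g i)) (total_graph h)).
  exact: Comp.
apply/funext => v; apply/funext => y; apply/propext; split=> [->|[w gw ->]].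
  by exists [tuple g i v | i < m] => [i|//]; rewrite tnth_mktuple.
by congr h; apply: eq_from_tnth => i; rewrite tnth_mktuple gw.
Qed.

Let rec_comp1 k (h : nat -> nat) (g : k.-tuple nat -> nat) :
  rec (fun v : 1.-tuple nat => h (thead v)) -> rec g -> rec (h \o g).
Proof.
move=> rh rg; have := rec_comp (g := fun _ => g) (fun _ => rg) rh.
by apply: rec_ext => v /=; rewrite /thead tnth_mktuple.
Qed.

Let rec_primrec k (F : nat -> k.-tuple nat -> nat) (h : k.+2.-tuple nat -> nat) :
  (forall n v, F n.+1 v = h [tuple of n :: F n v :: v]) ->
  rec (F 0) -> rec h -> rec (fun v => F (thead v) [tuple of behead v]).
Proof.
move=> FS rg rh; rewrite /rec.
rewrite (_ : total_graph _ = primrec_graph (total_graph (F 0)) (total_graph h)).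
  exact: Primrec.
apply/funext => v; apply/funext => y; apply/propext.
rewrite /primrec_graph /total_graph; move: (thead v) [tuple of behead v] => n w.
elim: n y => //= n IH y; rewrite FS; split=> [->|[z /IH -> ->//]].
by exists (F n w) => //; apply/IH.
Qed.

Let rec_iter k (F : nat -> k.-tuple nat -> nat) (h : k.+2.-tuple nat -> nat)
    (g : k.-tuple nat -> nat) :
  (forall n v, F n.+1 v = h [tuple of n :: F n v :: v]) ->
  rec (F 0) -> rec h -> rec g -> rec (fun v => F (g v) v).
Proof.
move=> FS r0 rh rg.
pose G (i : 'I_k.+1) (v : k.-tuple nat) :=
  if unlift ord0 i is Some j then tnth v j else g v.
have rG i : rec (G i).
  by rewrite /G; case: unliftP => [j _|_]; [apply: Proj|apply: rg].
have := rec_comp rG (rec_primrec FS r0 rh); apply: rec_ext => v.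
congr (F _ _); first by rewrite /thead tnth_mktuple /G unlift_none.
by apply: eq_from_tnth => i; rewrite tnth_behead tnth_mktuple
  (_ : inord _ = lift ord0 i) /G ?liftK//; apply/val_inj; rewrite /= inordK ?ltnS.
Qed.

Let hd := fun v : 1.-tuple nat => thead v.
Let rec_hd : rec hd. Proof. exact: (Proj f (@ord0 0)). Qed.

Let rec_succ k (g : k.-tuple nat -> nat) : rec g -> rec (fun v => (g v).+1).
Proof. exact: (rec_comp1 (h := succn) (Succ f)). Qed.

Let rec_isz k (g : k.-tuple nat -> nat) :
  rec g -> rec (fun v => (g v == 0 : nat)).
Proof.
move=> rg.
apply: (rec_iter (F := fun n (_ : k.-tuple nat) => n == 0 : nat)
  (h := fun _ => 0)) => //; first exact: (rec_succ (Zero f k)).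
exact: Zero.
Qed.

Let rec_odd k (g : k.-tuple nat -> nat) :
  rec g -> rec (fun v => odd (g v) : nat).
Proof.
apply: (rec_iter (F := fun n (_ : k.-tuple nat) => odd n : nat)
  (h := fun v => (tnth v (lift ord0 ord0) == 0 : nat))).
- by move=> n v; rewrite (tnth_nth 0) /=; case: odd.
- exact: Zero.
- by apply: rec_isz; apply: Proj.
Qed.

Let rec_add k (g h : k.-tuple nat -> nat) :
  rec g -> rec h -> rec (fun v => g v + h v).
Proof.
move=> rg rh.
have rG (i : 'I_2) : rec (fun v => if i == 0 :> nat then g v else h v).
  by case: (i == 0 :> nat).
pose F n (v : 2.-tuple nat) := n + tnth v (lift ord0 ord0).
have := rec_comp rG (rec_iter (F := F) (h := fun v =>
  (tnth v (lift ord0 ord0)).+1) _ _ _ (Proj f (@ord0 1))).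
move=> H; apply: rec_ext (H _ _ _) => //.
- by move=> v; rewrite /F !tnth_mktuple.
- exact: Proj.
- by apply: rec_succ; apply: Proj.
Qed.

Let rec_half k (g : k.-tuple nat -> nat) : rec g -> rec (fun v => (g v)./2).
Proof.
apply: (rec_iter (F := fun n (_ : k.-tuple nat) => n./2)
  (h := fun v => odd (tnth v ord0) + tnth v (lift ord0 ord0))).
- by move=> n v; rewrite !(tnth_nth 0) /= uphalf_half.
- exact: Zero.
- by apply: rec_add; [apply: rec_odd|]; apply: Proj.
Qed.

Let rec_if k (b : k.-tuple nat -> bool) (g h : k.-tuple nat -> nat) :
  rec (fun v => b v : nat) -> rec g -> rec h ->
  rec (fun v => if b v then g v else h v).
Proof.
move=> rb rg rh.
pose F n (v : k.-tuple nat) := if n is 0 then h v else g v.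
pose T (v : k.+2.-tuple nat) := [tuple tnth v (lift ord0 (lift ord0 i)) | i < k].
have := rec_iter (F := F) (h := fun v => g (T v)) _ rh _ rb.
move=> H; apply: rec_ext (H _ _) => //.
- by move=> v; rewrite /F; case: (b v).
- move=> n v /=; congr g; apply: eq_from_tnth => i.
  by rewrite tnth_mktuple !(tnth_nth 0).
- by apply: rec_comp => // i; apply: Proj.
Qed.

Lemma recursive_double_comp (h : nat -> nat) :
  rec (fun v : 1.-tuple nat => h (thead v)) ->
  rec (fun v : 1.-tuple nat => h (thead v).*2).
Proof.
move=> rh; apply: (rec_comp1 rh (g := fun v : 1.-tuple nat => (thead v).*2)).
by apply: rec_ext (rec_add rec_hd rec_hd) => v; rewrite addnn.
Qed.

Lemma recursive_doubleS_comp (h : nat -> nat) :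
  rec (fun v : 1.-tuple nat => h (thead v)) ->
  rec (fun v : 1.-tuple nat => h (thead v).*2.+1).
Proof.
move=> rh; apply: (rec_comp1 rh (g := fun v : 1.-tuple nat => (thead v).*2.+1)).
by apply/rec_succ/(rec_ext _ (rec_add rec_hd rec_hd)) => v; rewrite addnn.
Qed.

Lemma recursive_parity_comp (g h : nat -> nat) :
  rec (fun v : 1.-tuple nat => g (thead v)) ->
  rec (fun v : 1.-tuple nat => h (thead v)) ->
  rec (fun v : 1.-tuple nat =>
         if odd (thead v) then h (thead v)./2 else g (thead v)./2).
Proof.
move=> rg rh; apply: rec_if; first exact: (rec_odd rec_hd).
  exact: (rec_comp1 rh (rec_half rec_hd)).
exact: (rec_comp1 rg (rec_half rec_hd)).
Qed.

End TotalRecursive.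

Lemma char_turing_join A B n : char_fun (turing_join A B) n =
  if odd n then char_fun B n./2 else char_fun A n./2.
Proof.
rewrite /char_fun /turing_join -[in LHS](odd_double_half n).
case: odd; congr nat_of_bool; apply/idP/idP; rewrite !inE.
- move=> [[m _ /(congr1 odd)]|[m Bm]]; first by rewrite /= !odd_double.
  by move=> -[/double_inj <-].
- by move=> Bn; right; exists n./2.
- move=> [[m Am /double_inj <-//]|[m _ /(congr1 odd)]].
  by rewrite /= !odd_double.
- by move=> An; left; exists n./2.
Qed.

Lemma turing_join_lub A B C : turing_reducible (turing_join A B) C <->
  turing_reducible A C /\ turing_reducible B C.
Proof.
split=> [ABC|[AC BC]].
  split; apply: turing_reducible_trans ABC; rewrite /turing_reducible.
    rewrite [X in total_graph X](_ : _ = fun v : 1.-tuple nat =>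
      char_fun (turing_join A B) (thead v).*2).
      exact/recursive_double_comp/Oracle.
    by apply/funext => v; rewrite char_turing_join odd_double doubleK.
  rewrite [X in total_graph X](_ : _ = fun v : 1.-tuple nat =>
    char_fun (turing_join A B) (thead v).*2.+1).
    exact/recursive_doubleS_comp/Oracle.
  by apply/funext => v; rewrite char_turing_join /= odd_double /= uphalf_double.
rewrite /turing_reducible [X in total_graph X](_ : _ = fun v : 1.-tuple nat =>
  if odd (thead v) then char_fun B (thead v)./2 else char_fun A (thead v)./2).
  exact: recursive_parity_comp.
by apply/funext => v; rewrite char_turing_join.
Qed.

Lemma turing_reducible0 A : turing_reducible set0 A.
Proof.
rewrite /turing_reducible [X in total_graph X](_ : _ = fun=> 0).
  exact: Zero.
by apply/funext => v; rewrite /char_fun in_set0.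
Qed.

Definition turing_equiv (A B : set nat) : bool :=
  `[< turing_reducible A B /\ turing_reducible B A >].

Lemma turing_equiv_refl : reflexive turing_equiv.
Proof. by move=> A; apply/asboolP; split; apply: turing_reducible_refl. Qed.

Lemma turing_equiv_sym : symmetric turing_equiv.
Proof. by move=> A B; apply/asboolP/asboolP => -[]. Qed.

Lemma turing_equiv_trans : transitive turing_equiv.
Proof.
move=> B A C /asboolP[AB BA] /asboolP[BC CB]; apply/asboolP.
by split; apply: (@turing_reducible_trans B).
Qed.

Canonical turing_equiv_rel :=
  EquivRel turing_equiv turing_equiv_refl turing_equiv_sym turing_equiv_trans.

Definition turing_degree := {eq_quot turing_equiv}%qT.
HB.instance Definition _ := Choice.on turing_degree.

Definition deg (A : set nat) : turing_degree := \pi_({eq_quot turing_equiv})%qT A.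

Lemma deg_repr (a : turing_degree) : deg (repr a) = a.
Proof. exact: reprK. Qed.

Lemma deg_eqP A B :
  deg A = deg B <-> turing_reducible A B /\ turing_reducible B A.
Proof. by split=> [/eqmodP/asboolP|AB]; last by apply/eqmodP/asboolP. Qed.

Lemma repr_deg A : turing_reducible (repr (deg A)) A /\
  turing_reducible A (repr (deg A)).
Proof. by apply/deg_eqP; rewrite deg_repr. Qed.

Definition deg_le (a b : turing_degree) : bool :=
  `[< turing_reducible (repr a) (repr b) >].

Lemma deg_le_refl : reflexive deg_le.
Proof. by move=> a; apply/asboolP/turing_reducible_refl. Qed.

Lemma deg_le_anti : antisymmetric deg_le.
Proof.
move=> a b /andP[/asboolP ab /asboolP ba].
by rewrite -(deg_repr a) -(deg_repr b); apply/deg_eqP.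
Qed.

Lemma deg_le_trans : transitive deg_le.
Proof.
move=> b a c /asboolP ab /asboolP bc.
by apply/asboolP; apply: turing_reducible_trans ab bc.
Qed.

Fact turing_display : Order.disp_t. Proof. exact: Order.Disp tt tt. Qed.

HB.instance Definition _ := Order.Le_isPOrder.Build turing_display turing_degree
  deg_le_refl deg_le_anti deg_le_trans.

Lemma deg_leP A B : (deg A <= deg B)%O <-> turing_reducible A B.
Proof.
have [rA Ar] := repr_deg A; have [rB Br] := repr_deg B.
split=> [/asboolP AB|AB].
  exact: turing_reducible_trans Ar (turing_reducible_trans AB rB).
apply/asboolP; exact: turing_reducible_trans rA (turing_reducible_trans AB Br).
Qed.

Definition deg_join (a b : turing_degree) : turing_degree :=
  deg (turing_join (repr a) (repr b)).

Lemma deg_leUx a b c : (deg_join a b <= c)%O = (a <= c)%O && (b <= c)%O.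
Proof.
rewrite -[in RHS](deg_repr a) -[in RHS](deg_repr b) -(deg_repr c).
apply/idP/andP => [/deg_leP/turing_join_lub[ac bc]|[/deg_leP ac /deg_leP bc]].
  by split; apply/deg_leP.
by apply/deg_leP/turing_join_lub.
Qed.

HB.instance Definition _ := Order.POrder_isJoinSemilattice.Build
  turing_display turing_degree deg_leUx.

Lemma deg_joinE A B : (deg A `|` deg B)%O = deg (turing_join A B).
Proof.
apply/le_anti; rewrite leUx; apply/andP; split.
  have /turing_join_lub[Aj Bj] := turing_reducible_refl (turing_join A B).
  by apply/andP; split; apply/deg_leP.
have: (deg A <= deg A `|` deg B)%O by apply: leUl.
have: (deg B <= deg A `|` deg B)%O by apply: leUr.
rewrite -(deg_repr (deg A `|` deg B)%O) => /deg_leP Br /deg_leP Ar.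
by apply/deg_leP/turing_join_lub.
Qed.

Definition is_turing_ideal (I : set turing_degree) : Prop :=
  [/\ I !=set0,
      forall a c, I a -> (c <= a)%O -> I c
    & forall a c, I a -> I c -> I (a `|` c)%O].

Record turing_ideal := TuringIdeal {
  ideal_set :> set turing_degree;
  _ : `[< is_turing_ideal ideal_set >]
}.

HB.instance Definition _ := [isSub for ideal_set].
HB.instance Definition _ := [Choice of turing_ideal by <:].

Fact ideal_display : Order.disp_t. Proof. exact: Order.Disp tt tt. Qed.

HB.instance Definition _ :=
  [SubChoice_isSubPOrder of turing_ideal by <: with ideal_display].

Lemma turing_idealP (I : turing_ideal) : is_turing_ideal I.
Proof. by case: I => I /= /asboolP. Qed.

Lemma ideal_leP (I J : turing_ideal) : (I <= J)%O <-> I `<=` J.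
Proof. by rewrite -Order.le_val subsetEset. Qed.

Definition downset (a : turing_degree) : set turing_degree :=
  [set c | (c <= a)%O].

Lemma ideal_deg0 (I : turing_ideal) : ideal_set I (deg set0).
Proof.
have [[a Ia] Idown _] := turing_idealP I; apply: (Idown a) => //.
by rewrite -(deg_repr a); apply/deg_leP/turing_reducible0.
Qed.

Definition generated_set (S : set turing_degree) : set turing_degree :=
  \bigcap_(I in [set I : turing_ideal | S `<=` I]) I.

Lemma generated_set_ideal S : `[< is_turing_ideal (generated_set S) >].
Proof.
apply/asboolP; split.
- by exists (deg set0) => I _; apply: ideal_deg0.
- move=> a c Sa ca I SI; have [_ Idown _] := turing_idealP I.
  exact: Idown (Sa I SI) ca.
- move=> a c Sa Sc I SI; have [_ _ Ijoin] := turing_idealP I.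
  exact: Ijoin (Sa I SI) (Sc I SI).
Qed.

Definition generated_ideal (S : set turing_degree) : turing_ideal :=
  TuringIdeal (generated_set_ideal S).

Lemma generated_ideal_sub S : S `<=` generated_ideal S.
Proof. by move=> a Sa I /(_ a Sa). Qed.

Lemma generated_ideal_least S (I : turing_ideal) :
  S `<=` I -> (generated_ideal S <= I)%O.
Proof. by move=> SI; apply/ideal_leP => a /(_ I SI). Qed.

Definition U_map (A : set turing_degree) (b : turing_degree)
    (I : turing_ideal) : turing_ideal :=
  if `[< A `<=` I >] then generated_ideal (I `|` [set b]) else I.

Definition directed_set d (T : porderType d) (S : set T) : Prop :=
  S !=set0 /\
  forall x y, S x -> S y -> exists z, [/\ S z, (x <= z)%O & (y <= z)%O].

Definition scott_continuous d (T : porderType d) (f : T -> T) : Prop :=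
  forall (S : set T) (s : T),
    directed_set S -> supremums S s -> supremums (f @` S) (f s).

(* Main.v *)
(** The directed family of principal ideals [downset (a n)] has supremum [A],
    and [U_map A b] fixes each of them, since none contains [A].  Scott
    continuity would therefore make [U_map A b A] the least upper bound of the
    same family, hence contained in [A], although it contains [b]. *)

Require Import Defs.
From mathcomp Require Import all_boot all_order.
From mathcomp Require Import all_classical.
Import Order.Theory.
Local Open Scope classical_set_scope.

Lemma U_map_inflationary A b (I : turing_ideal) : (I <= U_map A b I)%O.
Proof.
rewrite /U_map; case: asboolP => // _; apply/ideal_leP => c Ic.
by apply: generated_ideal_sub; left.
Qed.

Lemma U_map_id A b (I : turing_ideal) : ~ A `<=` I -> U_map A b I = I.
Proof. by rewrite /U_map; case: asboolP. Qed.

Lemma U_map_mem A b (I : turing_ideal) : A `<=` I -> ideal_set (U_map A b I) b.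
Proof.
rewrite /U_map; case: asboolP => // _ _.
by apply: generated_ideal_sub; right.
Qed.

(** If [A] is not contained in [I], then [I] is fixed and inflation at [J] suffices. Otherwise [A]
    lies in [J] as well, so [U_map A b J] is an ideal containing both [I] and [b], and minimality of
    the generated ideal applies. *)
Lemma U_map_homo A b : {homo U_map A b : I J / (I <= J)%O}.
Proof.
move=> I J IJ; have [AI|nAI] := pselect (A `<=` I); last first.
  by rewrite (U_map_id _ _ _ nAI); apply: le_trans IJ (U_map_inflationary _ _ _).
have AJ : A `<=` J by apply: subset_trans AI _; apply/ideal_leP.
rewrite {1}/U_map asboolT//; apply: generated_ideal_least => c [Ic|->].
  have /ideal_leP := le_trans IJ (U_map_inflationary A b J); exact.
exact: U_map_mem.
Qed.

Lemma downset_ideal (a : turing_degree) : `[< is_turing_ideal (downset a) >].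
Proof.
apply/asboolP; split; first by exists a; rewrite /downset /=.
- by move=> c d ca dc; apply: le_trans dc ca.
- by move=> c d ca da; rewrite /downset /= leUx; apply/andP.
Qed.

Definition principal_ideal (a : turing_degree) : turing_ideal :=
  TuringIdeal (downset_ideal a).

Lemma principal_idealS (a c : turing_degree) :
  (a <= c)%O -> (principal_ideal a <= principal_ideal c)%O.
Proof. by move=> ac; apply/ideal_leP => d da; apply: le_trans da ac. Qed.

Section IncreasingSequence.
Variable a : nat -> turing_degree.
Hypothesis a_homo : {homo a : m n / m <= n >-> (m <= n)%O}.

Lemma bigcup_downset_ideal : `[< is_turing_ideal (\bigcup_n downset (a n)) >].
Proof.
apply/asboolP; split; first by exists (a 0), 0; rewrite // /downset /=.
- by move=> c d [n _ cn] dc; exists n => //; apply: le_trans dc cn.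
(* Two members enter at possibly different stages; both lie below the degree at the later stage,
   hence so does their join. *)
- move=> c d [m _ cm] [n _ dn]; exists (maxn m n) => //.
  rewrite /downset /= leUx; apply/andP; split.
    by apply: le_trans cm _; apply/a_homo/leq_maxl.
  by apply: le_trans dn _; apply/a_homo/leq_maxr.
Qed.

Lemma directed_principal_ideals :
  directed_set (range (fun n => principal_ideal (a n))).
Proof.
split; first by exists (principal_ideal (a 0)), 0.
move=> _ _ [m _ <-] [n _ <-]; exists (principal_ideal (a (maxn m n))).
by split; [exists (maxn m n)| |]; rewrite ?principal_idealS// a_homo//
  ?leq_maxl ?leq_maxr.
Qed.

(** The union is already an ideal, so no further closure is needed: any ideal above every
    [principal_ideal (a n)] contains the union pointwise. *)
Lemma supremums_principal_ideals :
  supremums (range (fun n => principal_ideal (a n)))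
    (TuringIdeal bigcup_downset_ideal).
Proof.
split=> [_ [n _ <-]|J ubJ]; first by apply/ideal_leP => c cn; exists n.
apply/ideal_leP => c [n _ cn].
have /ideal_leP : (principal_ideal (a n) <= J)%O by apply: ubJ; exists n.
exact.
Qed.

End IncreasingSequence.

Theorem theorem4p2 (a : nat -> turing_degree) (b : turing_degree)
    (A : set turing_degree)
    (a_incr : forall n : nat, (a n < a n.+1)%O)
    (A_def : A = \bigcup_n downset (a n))
    (a_le_b : forall n : nat, (a n <= b)%O)
    (b_notin_A : ~ A b) :
  {homo U_map A b : I J / (I <= J)%O} /\
  (forall I : turing_ideal, (I <= U_map A b I)%O) /\
  ~ scott_continuous (U_map A b).
Proof.
split; [exact: U_map_homo|split; [exact: U_map_inflationary|move=> Ucont]].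
have a_homo : {homo a : m n / m <= n >-> (m <= n)%O}.
  by apply: homo_leq => // [? ? ?|n]; [apply: le_trans|apply: ltW].
have sup := supremums_principal_ideals a a_homo.
have [_ least] := Ucont _ _ (directed_principal_ideals a a_homo) sup.
have /least/ideal_leP UA :
    ubound (U_map A b @` range (fun n => principal_ideal (a n)))
      (TuringIdeal (bigcup_downset_ideal a a_homo)).
  move=> _ [_ [n _ <-] <-]; rewrite U_map_id; first by apply: sup.1; exists n.
  (* Strictness of the sequence is used here: [a n.+1] belongs to [A] but is not below [a n], so it
     witnesses that [A] is not contained in the principal ideal of [a n]. *)
  move=> /(_ (a n.+1)) An; have : (a n.+1 <= a n)%O.
    by apply: An; rewrite A_def; exists n.+1; rewrite // /downset /=.
  by rewrite lt_geF.
(* The supremum has [A] itself as carrier, so [U_map] adjoins [b] to it, while [UA] keeps its value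
   inside [A]. *)
apply: b_notin_A; rewrite A_def; apply: UA.
by apply: U_map_mem; rewrite A_def.
Qed.
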